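(* Let $K$ be a field, $k\ge1$ an integer and $I\subset S=K[x_1,\ldots,x_n]$ a (proper) $k$-Borel ideal. Then for all $i,j$ the graded Betti numbers of $I$ are $$\beta_{i,i+j}(I)=\sum_{u\in G(I),\ \deg(u)=j}\binom{m(u)-L(u)-1}{i},$$ where $m(u)=\max(\operatorname{supp}(u))$ and $L(u)=|\{1\le \ell<m(u): \deg_{x_\ell}(u)=k\}|$.
   Context: For a monomial ideal $I$, $G(I)$ is its unique minimal set of monomial generators; $\operatorname{supp}(u)=\{i: x_i\mid u\}$. For $u=x_1^{a_1}\cdots x_n^{a_n}$, $\deg_{x_i}(u)=a_i$. A monomial $u=x_1^{a_1}\cdots x_n^{a_n}$ is $k$-bounded if $a_i\le k$ for all $i$; a monomial ideal is $k$-bounded if it is generated by $k$-bounded monomials. A $k$-bounded monomial ideal $I$ is $k$-Borel if for every $k$-bounded monomial $u\in I$, every $j\in\operatorname{supp}(u)$ and every $i<j$ one has $x_i(u/x_j)\in I$, provided $x_i(u/x_j)$ is $k$-bounded. $\beta_{i,r}(I)=\dim_K\operatorname{Tor}_i^S(K,I)_r$. *)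

(* Defs.v *)
From Stdlib Require Import ClassicalEpsilon.
From HB Require Import structures.
From mathcomp Require Import all_boot all_order all_algebra.
From mathcomp Require Import ring_quotient finmap.
From mathcomp Require Import mpoly.

Set Implicit Arguments.
Unset Strict Implicit.
Unset Printing Implicit Defensive.

Import GRing.Theory Num.Theory.
Local Open Scope ring_scope.

(* The variables x_1, ..., x_n are indexed by i : 'I_n, with x_(i + 1) for i;
   monomials are represented by their exponent vectors u : 'X_{1..n}. *)

Section MonomialIdeals.
Variables (K : fieldType) (n : nat).
Implicit Types (I : {pred {mpoly K[n]}}) (u : 'X_{1..n}).

Definition generates (A : 'X_{1..n} -> Prop) I : Prop :=
  forall p : {mpoly K[n]}, p \in I <->
    exists s : seq ({mpoly K[n]} * 'X_{1..n}),
      (forall t, t \in s -> A t.2) /\ p = \sum_(t <- s) t.1 * 'X_[t.2].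

Definition is_minimal_generators I (G : {fset 'X_{1..n}}) : Prop :=
  generates (fun u => u \in G) I /\
  forall H : {fset 'X_{1..n}},
    (H `<=` G)%fset -> generates (fun u => u \in H) I -> H = G.

Definition kbounded (k : nat) u : bool := [forall l : 'I_n, (u l <= k)%N].

Definition kbounded_ideal (k : nat) I : Prop :=
  exists2 A : 'X_{1..n} -> Prop,
    (forall u, A u -> kbounded k u) & generates A I.

(* x_i (u / x_j); the truncated subtraction is exact when x_j divides u. *)
Definition exchange u (j i : 'I_n) : 'X_{1..n} := (u - U_(j) + U_(i))%MM.

Definition kBorel (k : nat) I : Prop :=
  kbounded_ideal k I /\
  forall (u : 'X_{1..n}) (j i : 'I_n),
    kbounded k u -> ('X_[u] : {mpoly K[n]}) \in I ->
    (0 < u j)%N -> (i < j)%N ->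
    kbounded k (exchange u j i) ->
    ('X_[exchange u j i] : {mpoly K[n]}) \in I.

End MonomialIdeals.

(* m(u) = max (supp u), for supports numbered from 1 to n; it is 0 at u = 1,
   where m(u) is not defined. *)
Definition mvar (n : nat) (u : 'X_{1..n}) : nat :=
  \max_(l < n | (0 < u l)%N) l.+1.

Definition Lvar (k n : nat) (u : 'X_{1..n}) : nat :=
  #|[set l : 'I_n | (l.+1 < mvar u)%N && (u l == k)]|.

Section Betti.
Variables (K : fieldType) (n : nat).
Local Notation S := {mpoly K[n]}.

(* Data of an augmented complex ... -> F_2 -> F_1 -> F_0 -> S of graded free
   modules F_i = \bigoplus_(a < grank i) S(- gdeg a).  Elements of F_i are
   row vectors and maps act by right multiplication. *)
Record graded_free := GradedFree {
  grank : nat -> nat;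
  gdeg : forall i, 'I_(grank i) -> int;
  gdiff : forall i, 'M[S]_(grank i.+1, grank i);
  gaug : 'cV[S]_(grank 0)
}.

Definition homog_of_deg (d : int) (p : S) : Prop :=
  forall m, m \in msupp p -> (mdeg m)%:Z = d.

Definition is_resolution (I : {pred S}) (F : graded_free) : Prop :=
  [/\ (forall a, homog_of_deg (gdeg a) (gaug F a 0)) /\
      (forall i a b, homog_of_deg (gdeg a - gdeg b) (gdiff F i a b)),
      forall p, p \in I <-> exists v : 'rV[S]_(grank F 0), v *m gaug F = p%:M,
      forall v : 'rV[S]_(grank F 0),
        v *m gaug F = 0 <-> exists w, v = w *m gdiff F 0
    & forall i (v : 'rV[S]_(grank F i.+1)),
        v *m gdiff F i = 0 <-> exists w, v = w *m gdiff F i.+1].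

(* Tensoring with K = S / (x_1, ..., x_n) turns F_i into K^(grank i), with
   basis element a in degree gdeg a, and keeps the constant terms of the
   matrix entries. *)
Definition tor_diff (F : graded_free) (i : nat) :
    'M[K]_(grank F i.+1, grank F i) :=
  map_mx (fun p : S => p@_0%MM) (gdiff F i).

(* The row space of this matrix is the degree r component of K^(grank i). *)
Definition tor_part (F : graded_free) (i : nat) (r : int) : 'M[K]_(grank F i) :=
  diag_mx (\row_a (gdeg a == r)%:R).

Definition tor_cycles (F : graded_free) (i : nat) (r : int) :
    'M[K]_(grank F i) :=
  match i with
  | 0 => tor_part F 0 r
  | i'.+1 => (tor_part F i'.+1 r :&: kermx (tor_diff F i'))%MS
  end.

Definition tor_boundaries (F : graded_free) (i : nat) (r : int) :
    'M[K]_(grank F i.+1, grank F i) :=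
  tor_part F i.+1 r *m tor_diff F i.

(* The dimension over K of H_i(K \otimes_S F)_r. *)
Definition tor_dim (F : graded_free) (i : nat) (r : int) : nat :=
  (\rank (tor_cycles F i r) - \rank (tor_boundaries F i r))%N.

(* \dim_K Tor_i^S(K, I)_r, computed from a graded free resolution of I by
   finitely generated modules.  Such a resolution exists for every
   homogeneous ideal and the dimension does not depend on it. *)
Definition betti (I : {pred S}) (i : nat) (r : int) : nat :=
  epsilon (inhabits 0%N)
    (fun b => exists2 F : graded_free, is_resolution I F & b = tor_dim F i r).

End Betti.

(* Main.v *)
Require Import Defs.
From Stdlib Require Import ClassicalEpsilon.
From HB Require Import structures.
From mathcomp Require Import all_boot all_order all_algebra.
From mathcomp Require Import ring_quotient finmap.
From mathcomp Require Import mpoly zify.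

Set Implicit Arguments.
Unset Strict Implicit.
Unset Printing Implicit Defensive.

Import Order.TTheory GRing.Theory Num.Theory.
Local Open Scope ring_scope.

(* Order G(I) by increasing degree and, within a degree, lexicographically
   downwards from larger exponents of x_1.  If J is generated by the predecessors
   of u, then J : u is generated by the variables x_l with l < m(u) and
   deg_(x_l)(u) < k: the k-Borel property gives x_l u = x_m w with w in I, so x_l u
   is in J, and conversely a predecessor exceeding u in no such position could be
   moved by k-Borel exchanges to a proper divisor of u in I.  There are
   m(u) - L(u) - 1 such variables.
   Adjoining u to J is therefore a mapping cone of resolutions of J and of
   an ideal of variables (itself resolved by iterated cones); the cone is minimal
   for degree reasons, as u has the largest degree so far.  Finally, Tor does
   not depend on the resolution, by lifting and null homotopy. *)

(** * Graded matrices *)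

Section GradedMatrices.
Variables (K : fieldType) (n : nat).
Local Notation S := {mpoly K[n]}.
Implicit Types (p q : S) (z e : int).

(** The degree ranges over all integers, so later shifts such as [z - e] need no side condition:
    components of negative degree are 0. *)
Definition hcomp z p : S :=
  \sum_(m <- msupp p | (mdeg m)%:Z == z) p@_m *: 'X_[m].

Lemma mcoeff_hcomp z p m :
  (hcomp z p)@_m = if (mdeg m)%:Z == z then p@_m else 0.
Proof.
rewrite /hcomp raddf_sum /=; case: ifPn => hm.
  rewrite [in RHS](mpolyE p) raddf_sum /= big_mkcond /=.
  apply: eq_bigr => u _; rewrite mcoeffZ mcoeffX.
  case: (eqVneq u m) => [->|_]; last by rewrite mulr0; case: ifP.
  by rewrite hm.
rewrite big1 // => u hu; rewrite mcoeffZ mcoeffX.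
by case: (eqVneq u m) hm => [<-|]; rewrite ?(eqP hu) ?eqxx ?mulr0.
Qed.

Lemma homog_coeffP z p :
  homog_of_deg z p <-> forall m, p@_m != 0 -> (mdeg m)%:Z = z.
Proof. by split=> h m hm; apply: h; move: hm; rewrite mcoeff_msupp. Qed.

Lemma hcomp_homog z p : homog_of_deg z (hcomp z p).
Proof.
apply/homog_coeffP => m; rewrite mcoeff_hcomp.
by case: (_ =P z); rewrite ?eqxx.
Qed.

Lemma hcompE z p : homog_of_deg z p -> hcomp z p = p.
Proof.
move=> /homog_coeffP h; apply/mpolyP => m; rewrite mcoeff_hcomp.
by case: eqP => // hm; case: eqVneq (h m) => // _ /(_ isT).
Qed.

Lemma hcomp_sum z (J : Type) (r : seq J) (F : J -> S) :
  hcomp z (\sum_(t <- r) F t) = \sum_(t <- r) hcomp z (F t).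
Proof.
apply/mpolyP => m; rewrite mcoeff_hcomp (raddf_sum (mcoeff m)) [RHS]raddf_sum /=.
rewrite (eq_bigr _ (fun t _ => mcoeff_hcomp z (F t) m)).
by case: ifP; rewrite // big1.
Qed.

(** In the convolution formula for a coefficient, only terms whose right factor has degree [e]
    survive. *)
Lemma hcompMr z e p q : homog_of_deg e q -> hcomp z (p * q) = hcomp (z - e) p * q.
Proof.
move=> /homog_coeffP hq; apply/mpolyP => m; rewrite mcoeff_hcomp !mcoeffM.
have E (k : 'X_{1..n < (mdeg m).+1, (mdeg m).+1}) : m == (k.1 + k.2)%MM ->
    (hcomp (z - e) p)@_k.1 * q@_k.2 =
    if (mdeg m)%:Z == z then p@_k.1 * q@_k.2 else 0.
  move=> /eqP/(congr1 (fun u => (mdeg u)%:Z)); rewrite mdegD PoszD => ->.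
  rewrite mcoeff_hcomp; have [->|/hq he] := eqVneq q@_k.2 0.
    by rewrite !mulr0; case: ifP.
  by rewrite he eq_sym subr_eq eq_sym; case: ifP; rewrite ?mul0r.
by rewrite (eq_bigr _ E); case: ifP => // _; rewrite big1.
Qed.

Lemma homog0 z : homog_of_deg z (0 : S).
Proof. by apply/homog_coeffP => m; rewrite mcoeff0 eqxx. Qed.

Lemma homogD z p q : homog_of_deg z p -> homog_of_deg z q -> homog_of_deg z (p + q).
Proof.
move=> /homog_coeffP hp /homog_coeffP hq; apply/homog_coeffP => m.
rewrite mcoeffD; have [->|/hp //] := eqVneq p@_m 0.
by rewrite add0r => /hq.
Qed.

Lemma homogN z p : homog_of_deg z p -> homog_of_deg z (- p).
Proof.
by move=> /homog_coeffP hp; apply/homog_coeffP => m; rewrite mcoeffN oppr_eq0 => /hp.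
Qed.

Lemma homogM z e p q :
  homog_of_deg z p -> homog_of_deg e q -> homog_of_deg (z + e) (p * q).
Proof.
move=> hp hq; have := @hcomp_homog (z + e) (p * q).
by rewrite (hcompMr _ _ hq) addrK hcompE.
Qed.

Lemma homog1 : homog_of_deg 0 (1 : S).
Proof.
by apply/homog_coeffP => m; rewrite mcoeff1; case: (m =P 0%MM) => [->|]; rewrite ?mdeg0 ?eqxx.
Qed.

Lemma homogX (u : 'X_{1..n}) : homog_of_deg (mdeg u)%:Z ('X_[u] : S).
Proof.
by apply/homog_coeffP => m; rewrite mcoeffX; case: (u =P m) => [->|]; rewrite ?eqxx.
Qed.

Lemma homog_sum z (J : Type) (r : seq J) (F : J -> S) :
  (forall t, homog_of_deg z (F t)) -> homog_of_deg z (\sum_(t <- r) F t).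
Proof.
move=> h; elim: r => [|t r IH]; first by rewrite big_nil; apply: homog0.
by rewrite big_cons; apply: homogD.
Qed.

(** These are the degree-preserving maps of graded free modules whose basis elements have degrees
    [da s] and [db t]. *)
Definition homog_mx a b (da : 'I_a -> int) (db : 'I_b -> int) (A : 'M[S]_(a, b)) :=
  forall s t, homog_of_deg (da s - db t) (A s t).

Lemma homog_mx0 a b (da : 'I_a -> int) (db : 'I_b -> int) :
  homog_mx da db 0.
Proof. by move=> s t; rewrite mxE; apply: homog0. Qed.

Lemma homog_mxB a b (da : 'I_a -> int) (db : 'I_b -> int) A B :
  homog_mx da db A -> homog_mx da db B -> homog_mx da db (A - B).
Proof. by move=> hA hB s t; rewrite !mxE; apply: homogD => //; apply: homogN. Qed.

Lemma homog_mxN a b (da : 'I_a -> int) (db : 'I_b -> int) A :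
  homog_mx da db A -> homog_mx da db (- A).
Proof. by move=> hA s t; rewrite !mxE; apply: homogN. Qed.

Lemma homog_mx1 a (da : 'I_a -> int) : homog_mx da da 1%:M.
Proof.
move=> s t; rewrite mxE; case: eqVneq => [->|_]; last exact: homog0.
by rewrite subrr; apply: homog1.
Qed.

Lemma homog_mxM a b c (da : 'I_a -> int) (db : 'I_b -> int) (dc : 'I_c -> int) A B :
  homog_mx da db A -> homog_mx db dc B -> homog_mx da dc (A *m B).
Proof.
move=> hA hB s t; rewrite mxE; apply: homog_sum => x.
by rewrite -(subrK (db x) (da s)) -addrA; apply: homogM.
Qed.

Lemma rowwise_lift a b c (A : 'M[S]_(a, c)) (D : 'M[S]_(b, c)) :
  (forall s, exists w : 'rV_b, row s A = w *m D) -> exists W, A = W *m D.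
Proof.
move=> h; pose w s := proj1_sig (constructive_indefinite_description _ (h s)).
exists (\matrix_s w s); apply/row_matrixP => s.
rewrite row_mul rowK /w; by case: constructive_indefinite_description.
Qed.

(** Any solution [W] can be made homogeneous: keeping in each entry only the component of the right
    degree changes nothing in the product, because [A] and [D] are homogeneous. *)
Lemma homog_lift a b c (da : 'I_a -> int) (db : 'I_b -> int) (dc : 'I_c -> int)
    (A : 'M[S]_(a, c)) (D : 'M[S]_(b, c)) :
  homog_mx da dc A -> homog_mx db dc D -> (exists W, A = W *m D) ->
  exists2 W, homog_mx da db W & A = W *m D.
Proof.
move=> hA hD [W AE]; exists (\matrix_(s, t) hcomp (da s - db t) (W s t)).
  by move=> s t; rewrite mxE; apply: hcomp_homog.
apply/matrixP => s t; rewrite -(hcompE (hA s t)) AE !mxE hcomp_sum.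
apply: eq_bigr => x _; rewrite mxE (hcompMr _ _ (hD x t)); congr (hcomp _ _ * _).
by rewrite opprB addrA subrK.
Qed.

End GradedMatrices.

(** * Independence of the resolution *)

(** The types vary with the index because matrix sizes do. [P] is the invariant that keeps the
    recursion going, and [R] links consecutive terms. *)
Lemma dependent_choice_seq (T : nat -> Type) (P : forall i, T i -> Prop)
    (R : forall i, T i -> T i.+1 -> Prop) (x0 : T 0) :
    P 0 x0 -> (forall i x, P i x -> exists2 y, P i.+1 y & R i x y) ->
  exists f : forall i, T i, [/\ f 0 = x0, forall i, P i (f i)
    & forall i, R i (f i) (f i.+1)].
Proof.
move=> P0 step.
have step' i (x : {x | P i x}) : exists y : {y | P i.+1 y}, R i (sval x) (sval y).
  by have [y Py Rxy] := step i _ (svalP x); exists (exist _ y Py).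
pose g := fix g i : {x | P i x} := match i with
  | 0 => exist _ x0 P0
  | i'.+1 => sval (constructive_indefinite_description _ (step' i' (g i')))
  end.
exists (fun i => sval (g i)); split=> // [i|i]; first exact: svalP.
by rewrite /=; case: constructive_indefinite_description.
Qed.

Section Resolutions.
Variables (K : fieldType) (n : nat).
Local Notation S := {mpoly K[n]}.
Implicit Types (F : graded_free K n) (I : {pred S}).

(* Shifting by one degree puts the augmentation on the same footing as the
   other differentials. *)
Definition erank F i : nat := if i is i'.+1 then grank F i' else 1.

Definition edeg F i : 'I_(erank F i) -> int :=
  match i with 0 => fun=> 0 | i'.+1 => @gdeg _ _ F i' end.

Definition ediff F i : 'M[S]_(erank F i.+1, erank F i) :=
  match i with 0 => gaug F | i'.+1 => gdiff F i' end.

Lemma is_resolutionE I F : is_resolution I F <->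
  [/\ forall i, homog_mx (@edeg F i.+1) (@edeg F i) (ediff F i),
      forall p, p \in I <-> exists v, v *m ediff F 0 = p%:M
    & forall i (v : 'rV_(erank F i.+1)),
        v *m ediff F i = 0 <-> exists w, v = w *m ediff F i.+1].
Proof.
split=> [[[h0 h1] hI e0 e1]|[h hI e]].
  split=> [[|i] s t||[|i]].
  - by rewrite ord1 subr0; apply: h0.
  - exact: h1.
  - exact: hI.
  - exact: e0.
  - exact: e1.
split=> //; last by move=> i; apply: (e i.+1).
  by split=> [a|i]; [have := h 0 a 0; rewrite subr0|apply: (h i.+1)].
exact: (e 0).
Qed.

Section Exactness.
Variables (I : {pred S}) (F : graded_free K n).
Hypothesis resF : is_resolution I F.

Lemma ediff_homog i : homog_mx (@edeg F i.+1) (@edeg F i) (ediff F i).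
Proof. by have [h _ _] := (is_resolutionE I F).1 resF; apply: h. Qed.

Arguments ediff_homog : clear implicits.

Lemma ediffK i : ediff F i.+1 *m ediff F i = 0.
Proof.
have [_ _ e] := (is_resolutionE I F).1 resF; apply/row_matrixP => s.
by rewrite row_mul row0; apply/e; exists (delta_mx 0 s); rewrite rowE.
Qed.

Lemma ediff_exact m i (A : 'M_(m, erank F i.+1)) (dA : 'I_m -> int) :
    homog_mx dA (@edeg F i.+1) A -> A *m ediff F i = 0 ->
  exists2 W, homog_mx dA (@edeg F i.+2) W & A = W *m ediff F i.+1.
Proof.
move=> hA A0; have [_ _ e] := (is_resolutionE I F).1 resF.
apply: homog_lift => //; first exact: ediff_homog.
by apply: rowwise_lift => s; apply/e; rewrite -row_mul A0 row0.
Qed.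

(** The lifting half of the comparison theorem: the source need only be a complex, the target is
    exact. The first lift is a hypothesis, since exactness says nothing about the cokernel of the
    augmentation. *)
Lemma chain_lift (r : nat -> nat) (dr : forall i, 'I_(r i) -> int)
    (D : forall i, 'M[S]_(r i.+1, r i)) (psi0 : 'M_(r 0, erank F 0)) :
    (forall i, homog_mx (@dr i.+1) (@dr i) (D i)) ->
    (forall i, D i.+1 *m D i = 0) ->
    homog_mx (@dr 0) (@edeg F 0) psi0 ->
    (exists W, D 0 *m psi0 = W *m ediff F 0) ->
  exists psi : forall i, 'M_(r i, erank F i),
    [/\ psi 0 = psi0, forall i, homog_mx (@dr i) (@edeg F i) (psi i)
      & forall i, D i *m psi i = psi i.+1 *m ediff F i].
Proof.
move=> hD DK h0 lift0.
pose P i psi := homog_mx (@dr i) (@edeg F i) psi /\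
  exists W, D i *m psi = W *m ediff F i.
pose R i (psi : 'M_(r i, erank F i)) psi' := D i *m psi = psi' *m ediff F i.
have [|i psi [hpsi ex]|psi [psi0E Ppsi Rpsi]] :=
  @dependent_choice_seq _ P R psi0.
- by split.
- have [psi' hpsi' psi'E] := homog_lift (homog_mxM (hD i) hpsi) (ediff_homog i) ex.
  exists psi' => //; split=> //.
  have DK0 : D i.+1 *m psi' *m ediff F i = 0.
    by rewrite -mulmxA -psi'E mulmxA DK mul0mx.
  by have [W _ WE] := ediff_exact (homog_mxM (hD i.+1) hpsi') DK0; exists W.
by exists psi; split=> // i; case: (Ppsi i).
Qed.

(** At each stage the part of [c] not yet accounted for is killed by the differential of [F], so
    exactness yields the next component of the homotopy. *)
Lemma null_homotopy (c : forall i, 'M_(erank F i)) :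
    c 0 = 0 -> (forall i, homog_mx (@edeg F i) (@edeg F i) (c i)) ->
    (forall i, ediff F i *m c i = c i.+1 *m ediff F i) ->
  exists h : forall i, 'M_(erank F i, erank F i.+1),
    [/\ h 0 = 0, forall i, homog_mx (@edeg F i) (@edeg F i.+1) (h i)
      & forall i, c i.+1 = ediff F i *m h i + h i.+1 *m ediff F i.+1].
Proof.
move=> c0 hc comm.
pose P i h := homog_mx (@edeg F i) (@edeg F i.+1) h /\
  (c i.+1 - ediff F i *m h) *m ediff F i = 0.
pose R i (h : 'M_(erank F i, erank F i.+1)) h' :=
  c i.+1 - ediff F i *m h = h' *m ediff F i.+1.
have [|i h [hh ex]|h [h0 Ph Rh]] := @dependent_choice_seq _ P R 0.
- split; first exact: homog_mx0.
  by rewrite mulmx0 subr0 -comm c0 mulmx0.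
- have hd := homog_mxB (hc i.+1) (homog_mxM (ediff_homog i) hh).
  have [h' hh' h'E] := ediff_exact hd ex.
  exists h' => //; split=> //.
  (* Both terms equal [ediff F i.+1 *m c i.+1]: the first because [c] is a chain map, the second by
     the choice of [h'] and since the differential squares to 0. *)
  rewrite mulmxBl -comm -mulmxA -h'E mulmxBr mulmxA ediffK mul0mx subr0.
  by rewrite subrr.
exists h; split=> // i; first by case: (Ph i).
by rewrite -(Rh i) addrC subrK.
Qed.

End Exactness.
Arguments ediff_homog {I F} resF i s t m.

(** * Constant terms and the dimension of Tor *)

Definition cst_mx a b (A : 'M[S]_(a, b)) : 'M[K]_(a, b) :=
  map_mx (fun p : S => p@_0%MM) A.

Lemma cst_mxM a b c (A : 'M[S]_(a, b)) (B : 'M[S]_(b, c)) :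
  cst_mx (A *m B) = cst_mx A *m cst_mx B.
Proof. exact: (map_mxM (mcoeff 0%MM)). Qed.

Lemma cst_mxD a b (A B : 'M[S]_(a, b)) : cst_mx (A + B) = cst_mx A + cst_mx B.
Proof. by apply/matrixP => s t; rewrite !mxE mcoeffD. Qed.

Lemma cst_mxB a b (A B : 'M[S]_(a, b)) : cst_mx (A - B) = cst_mx A - cst_mx B.
Proof. by apply/matrixP => s t; rewrite !mxE mcoeffB. Qed.

Lemma cst_mx1 a : cst_mx 1%:M = 1%:M :> 'M_a.
Proof. exact: (map_mx1 (mcoeff 0%MM)). Qed.

Lemma cst_mx0 a b : cst_mx 0 = 0 :> 'M_(a, b).
Proof. exact: (map_mx0 (mcoeff 0%MM)). Qed.

Definition deg_part a (da : 'I_a -> int) (r : int) : 'M[K]_a :=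
  diag_mx (\row_s (da s == r)%:R).

Lemma cst_homog_eq0 z (p : S) : homog_of_deg z p -> z != 0 -> p@_0%MM = 0.
Proof.
move=> /homog_coeffP hp /eqP z0; case: (p@_0%MM =P 0) => // /eqP /hp.
by rewrite mdeg0 => /esym.
Qed.

(** A constant entry of a homogeneous matrix can be nonzero only between basis elements of equal
    degree. *)
Lemma deg_part_cst a b (da : 'I_a -> int) (db : 'I_b -> int) r (A : 'M[S]_(a, b)) :
  homog_mx da db A -> deg_part da r *m cst_mx A = cst_mx A *m deg_part db r.
Proof.
move=> hA; rewrite mul_diag_mx mul_mx_diag; apply/matrixP => s t; rewrite !mxE mulrC.
have [->//|ne] := eqVneq (da s) (db t).
by rewrite (cst_homog_eq0 (hA s t)) ?subr_eq0 // !mul0r.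
Qed.

Lemma sub_deg_part_cst m a b (da : 'I_a -> int) (db : 'I_b -> int) r
    (z : 'M_(m, a)) (A : 'M[S]_(a, b)) :
  homog_mx da db A -> (z <= deg_part da r)%MS ->
  (z *m cst_mx A <= deg_part db r)%MS.
Proof.
move=> hA /submxP [w ->]; rewrite -mulmxA (deg_part_cst r hA) mulmxA.
exact: submxMl.
Qed.

(* Membership in the cycles, uniformly in i: in position 0 the augmentation
   plays no role. *)
Lemma sub_tor_cycles F i r m (z : 'M_(m, grank F i)) :
  (z <= tor_cycles F i r)%MS =
  (z <= deg_part (@gdeg _ _ F i) r)%MS &&
    ((i == 0) || (z *m cst_mx (ediff F i) == 0)).
Proof.
case: i z => [|i] z /=; first by rewrite andbT.
by rewrite sub_capmx; congr (_ && _); apply/sub_kermxP/eqP.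
Qed.

(** The composite of [f] with the projection modulo [B'] sends [Z] into [Z'] modulo [B'] with kernel
    inside [B]; rank-nullity does the rest. *)
Lemma rank_quot_leq a b (Z : 'M[K]_a) m (B : 'M_(m, a)) (Z' : 'M_b) m'
    (B' : 'M_(m', b)) (f : 'M_(a, b)) :
    (Z *m f <= Z')%MS -> (B' <= Z')%MS ->
    (forall z : 'rV_a, (z <= Z)%MS -> (z *m f <= B')%MS -> (z <= B)%MS) ->
  (\rank Z - \rank B <= \rank Z' - \rank B')%N.
Proof.
move=> fZ BZ inj; set C := cokermx B'.
have CE k (x : 'M_(k, b)) : (x <= B')%MS = (x *m C == 0) by rewrite submxE.
have le1 : (Z :&: kermx (f *m C) <= B)%MS.
  apply/row_subP => s; have := row_sub s (Z :&: kermx (f *m C))%MS.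
  rewrite sub_capmx => /andP [hz /sub_kermxP hk]; apply: inj => //.
  by rewrite CE -mulmxA hk.
have le2 : (B' <= Z' :&: kermx C)%MS.
  by rewrite sub_capmx BZ; apply/sub_kermxP/eqP; rewrite -CE.
rewrite -(mxrank_mul_ker Z (f *m C)) -(mxrank_mul_ker Z' C).
have := mxrankS le1; have := mxrankS le2.
have : (Z' :&: kermx C <= B')%MS.
  by rewrite CE; apply/eqP/sub_kermxP; rewrite capmxSr.
move=> /mxrankS le3 le4 le5.
have : (\rank (Z *m (f *m C)) <= \rank (Z' *m C))%N.
  by rewrite mulmxA mxrankS // submxMr.
move: le3 le4 le5; lia.
Qed.

Section Comparison.
Variables (I : {pred S}) (F F' : graded_free K n).
Hypotheses (resF : is_resolution I F) (resF' : is_resolution I F').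

(** The identity of S lifts because both augmentations have image [I]. *)
Lemma resolution_chain_map :
  exists f : forall i, 'M_(erank F i, erank F' i),
    [/\ f 0 = 1%:M, forall i, homog_mx (@edeg F i) (@edeg F' i) (f i)
      & forall i, ediff F i *m f i = f i.+1 *m ediff F' i].
Proof.
apply: (chain_lift resF').
- exact: ediff_homog resF.
- exact: ediffK resF.
- exact: homog_mx1.
rewrite mulmx1; apply: rowwise_lift => s.
have [_ hI _] := (is_resolutionE I F).1 resF.
have [_ hI' _] := (is_resolutionE I F').1 resF'.
have /hI' [w wE] : ediff F 0 s 0 \in I.
  apply/hI; exists (delta_mx 0 s); rewrite -rowE.
  by apply/rowP => t; rewrite !ord1 !mxE.
by exists w; rewrite wE; apply/rowP => t; rewrite !ord1 !mxE.
Qed.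

End Comparison.

Lemma tor_boundaries_sub_cycles I F i r : is_resolution I F ->
  (tor_boundaries F i r <= tor_cycles F i r)%MS.
Proof.
move=> resF; rewrite sub_tor_cycles; apply/andP; split.
  exact: sub_deg_part_cst (ediff_homog resF i.+1) (submx_refl _).
by rewrite -mulmxA -cst_mxM (ediffK resF i) cst_mx0 mulmx0 eqxx orbT.
Qed.

(** Lifts [f] and [g] of the identity compose to a map homotopic to the identity, so [f] is
    injective on homology. Exchanging [F] and [F'] gives the other inequality. *)
Lemma tor_dim_leq I F F' i r : is_resolution I F -> is_resolution I F' ->
  (tor_dim F i r <= tor_dim F' i r)%N.
Proof.
move=> resF resF'.
have [f [f0 hf cf]] := resolution_chain_map resF resF'.
have [g [g0 hg cg]] := resolution_chain_map resF' resF.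
have [||j|h [h0 hh hE]] := @null_homotopy I F resF (fun j => 1%:M - f j *m g j).
- by rewrite f0 g0 mulmx1 subrr.
- move=> j; apply: homog_mxB; first exact: homog_mx1.
  exact: homog_mxM (hf j) (hg j).
- by rewrite mulmxBr mulmxBl mulmx1 mul1mx mulmxA cf -!mulmxA cg.
apply: (@rank_quot_leq _ _ _ _ _ _ _ _ (cst_mx (f i.+1))).
- have := submx_refl (tor_cycles F i r); rewrite {2}/is_true sub_tor_cycles.
  move=> /andP [hd hz]; rewrite sub_tor_cycles (sub_deg_part_cst (hf i.+1)) //=.
  case/orP: hz => [->//|/eqP hz]; apply/orP; right.
  by rewrite -mulmxA -cst_mxM -cf cst_mxM mulmxA hz mul0mx.
- exact: tor_boundaries_sub_cycles resF'.
move=> z; rewrite sub_tor_cycles => /andP [hd hz] zf.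
(* The homotopy identity, reduced to constant terms and applied to the cycle [z]. *)
have -> : z = z *m cst_mx (f i.+1) *m cst_mx (g i.+1)
    + z *m cst_mx (h i.+1) *m cst_mx (ediff F i.+1).
  have := congr1 (fun A => z *m cst_mx A) (hE i).
  rewrite cst_mxB cst_mxD !cst_mxM cst_mx1 mulmxBr mulmxDr mulmx1 !mulmxA.
  (* In position 0 the augmentation need not kill [z], but there the homotopy component [h 0] is
     0. *)
  have -> : z *m cst_mx (ediff F i) *m cst_mx (h i) = 0.
    case/orP: hz => [/eqP i0|/eqP ->]; last by rewrite mul0mx.
    have -> : h i = 0 by rewrite i0.
    by rewrite cst_mx0 mulmx0.
  by rewrite add0r => <-; rewrite addrC subrK.
apply: addmx_sub.
  apply: submx_trans (submxMr _ zf) _; rewrite /tor_boundaries.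
  rewrite -mulmxA -[tor_diff F' i]/(cst_mx (ediff F' i.+1)) -cst_mxM cg cst_mxM.
  rewrite mulmxA; apply: submxMr; exact: sub_deg_part_cst (hg i.+2) (submx_refl _).
apply: submxMr; exact: sub_deg_part_cst (hh i.+1) hd.
Qed.

Lemma betti_tor_dim I F i r : is_resolution I F -> betti I i r = tor_dim F i r.
Proof.
move=> resF; have : exists b, exists2 F, is_resolution I F & b = tor_dim F i r.
  by exists (tor_dim F i r), F.
move=> /(epsilon_spec (inhabits 0%N)) [F' resF' E].
by rewrite /betti E; apply/eqP; rewrite eqn_leq !(@tor_dim_leq I).
Qed.

End Resolutions.

Arguments ediff_homog {K n I F} resF i s t m.

(** * Mapping cones *)

Section MappingCone.
Variables (K : fieldType) (n : nat).
Local Notation S := {mpoly K[n]}.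
Implicit Types (F Q : graded_free K n) (I J : {pred S}).

(** Exactness of the cone at one spot: lift [v2], subtract the contribution of that lift from [v1],
    and lift the remainder, which is a cycle by anticommutation. *)
Lemma cone_lift (a2 a1 a0 b2 b1 : nat) (D1 : 'M[S]_(a2, a1)) (D0 : 'M[S]_(a1, a0))
    (E1 : 'M[S]_(b2, b1)) (f1 : 'M[S]_(b2, a1)) (f0 : 'M[S]_(b1, a0))
    (v1 : 'rV_a1) (v2 : 'rV_b1) :
    (forall v : 'rV_a1, v *m D0 = 0 -> exists w, v = w *m D1) ->
    f1 *m D0 = - E1 *m f0 -> v1 *m D0 + v2 *m f0 = 0 ->
    (exists w, v2 = w *m E1) ->
  exists w, row_mx v1 v2 = w *m block_mx D1 0 f1 E1.
Proof.
move=> exD anti v0 [w2 v2E].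
have /exD [w1 w1E] : (v1 - w2 *m f1) *m D0 = 0.
  by rewrite mulmxBl -mulmxA anti mulNmx mulmxN opprK mulmxA -v2E.
exists (row_mx w1 w2); rewrite mul_row_block mulmx0 add0r -v2E.
by rewrite -w1E subrK.
Qed.

(** Using [erank] shifts [Q] by one position: at position 0 it contributes S itself, whose basis
    element maps to the new generator [p]. *)
Definition cone F Q (d : int) (p : S)
    (f : forall i, 'M[S]_(erank Q i.+1, grank F i)) : graded_free K n :=
  @GradedFree K n (fun i => (grank F i + erank Q i)%N)
    (fun i s => match split s with
                | inl a => gdeg a
                | inr b => edeg b + d
                end)
    (fun i => block_mx (gdiff F i) 0 (f i) (ediff Q i))
    (col_mx (gaug F) p%:M).

(** Here [J] is the colon I : p and [I'] is I + (p), so multiplication by [p] embeds S/J in S/I with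
    cokernel S/I'. The map [f] lifts this multiplication. *)
Lemma cone_resolution I J I' F Q d p :
    is_resolution I F -> is_resolution J Q -> homog_of_deg d p ->
    (forall q, q \in J <-> q * p \in I) ->
    (forall q, q \in I' <-> exists2 q', q' \in I & exists c, q = q' + c * p) ->
  exists f : forall i, 'M[S]_(erank Q i.+1, grank F i),
    (forall i, homog_mx (fun s => @edeg _ _ Q i.+1 s + d) (@gdeg _ _ F i) (f i)) /\
    is_resolution I' (cone d p f).
Proof.
move=> resF resQ hp colon sum.
have [hF FI FK] := (is_resolutionE I F).1 resF.
have [hQ QJ QK] := (is_resolutionE J Q).1 resQ.
pose dr i s := @edeg _ _ Q i s + d.
(* Negating the differentials of [Q] makes the lift anticommute, as the square of the cone
   differential requires. *)
have [||||psi [psi0 hpsi psiE]] := @chain_lift _ _ _ _ resF _ dr (fun i => - ediff Q i) p%:M.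
- move=> i; apply: homog_mxN => s t; rewrite /dr [edeg t + d]addrC addrKA.
  exact: hQ.
- by move=> i; rewrite mulNmx mulmxN (ediffK resQ) !oppr0.
- by move=> s t; rewrite !ord1 mxE eqxx /dr /= subr0 add0r.
- apply: rowwise_lift => j; have /colon : - ediff Q 0 j 0 \in J.
    apply/QJ; exists (- delta_mx 0 j); rewrite mulNmx -rowE.
    by apply/rowP => t; rewrite !ord1 !mxE.
  move=> /FI [w wE]; exists w; rewrite wE; apply/rowP => t.
  by rewrite !ord1 !mxE big_ord1 !mxE.
pose f i := psi i.+1; exists f; split; first by move=> i; apply: hpsi.
have f0E : f 0 *m gaug F = - ediff Q 0 *m p%:M by rewrite -psi0 psiE.
have fSE i : f i.+1 *m gdiff F i = - ediff Q i.+1 *m f i by rewrite /f psiE.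
split.
- split=> [s|i s t] /=.
    rewrite mxE; case: split => x; first by have := hF 0 x 0; rewrite subr0.
    by rewrite ord1 mxE eqxx /= add0r.
  rewrite mxE; case: split => x; rewrite mxE; case: split => y.
  + exact: hF i.+1 x y.
  + by rewrite mxE; apply: homog0.
  + exact: hpsi.
  + by rewrite [_ y + d]addrC addrKA; apply: hQ.
- move=> q; split.
    move=> /sum [q' /FI [v vE] [c ->]]; exists (row_mx v c%:M).
    by rewrite /= mul_row_col [_ *m gaug F]vE -scalar_mxM raddfD.
  case=> v; rewrite -(hsubmxK v) /= mul_row_col => vE; apply/sum.
  exists ((lsubmx v *m gaug F) 0 0).
    by apply/FI; exists (lsubmx v); apply/rowP => t; rewrite !ord1 !mxE.
  exists (rsubmx v 0 0); have := congr1 (fun A : 'M_1 => A 0 0) vE.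
  by rewrite /= mul_mx_scalar mxE [RHS]mxE [X in _ + X]mxE mulrC => ->.
- move=> v; rewrite -(hsubmxK v) /=; split=> [|[w ->]].
    rewrite mul_row_col => v0; apply: (cone_lift _ f0E v0) => [x /(FK 0)//|].
    (* The coefficient of [p] in a syzygy multiplies [p] into [I], hence lies in the colon [J]. *)
    suff /QJ [w wE] : rsubmx v 0 0 \in J.
      by exists w; rewrite [RHS]wE; apply/rowP => t; rewrite !ord1 !mxE.
    apply/colon/FI; exists (- lsubmx v); rewrite mulNmx.
    apply/eqP; rewrite eqr_oppLR -addr_eq0 -v0 eq_sym; apply/eqP.
    by rewrite mul_mx_scalar; apply/rowP => t; rewrite !ord1 !mxE mulrC.
  rewrite -mulmxA mul_block_col f0E -[gdiff F 0 *m _]/(ediff F 1 *m ediff F 0).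
  by rewrite (ediffK resF) mul0mx addr0 mulNmx addNr col_mx0 mulmx0.
- move=> i v; rewrite -(hsubmxK v) /=; split=> [|[w ->]].
    rewrite mul_row_block mulmx0 add0r -[RHS]row_mx0 => /eq_row_mx [v0 v1].
    by apply: (cone_lift _ (fSE i) v0) => [x /(FK i.+1)//|]; apply/QK.
  rewrite -mulmxA mulmx_block fSE !mulmx0 !mul0mx.
  rewrite -[gdiff F i.+1 *m _]/(ediff F i.+2 *m ediff F i.+1).
  by rewrite (ediffK resF) (ediffK resQ) !addr0 mulNmx addNr block_mx0 mulmx0.
Qed.

(** A minimal resolution has differentials without constant terms; [hi] bounds the regularity and
    [b] is the Betti table. *)
Definition min_resolution I (hi : int) (b : nat -> int -> nat) : Prop :=
  exists F, [/\ is_resolution I F, forall i, tor_diff F i = 0,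
    forall i a, i%:Z < @gdeg _ _ F i a <= i%:Z + hi
    & forall i r, \rank (tor_part F i r) = b i r].

(** All differentials vanish after tensoring with K, so the boundaries are 0 and every element is a
    cycle. *)
Lemma min_resolution_betti I hi b i r : min_resolution I hi b -> betti I i r = b i r.
Proof.
case=> F [resF min _ rk]; rewrite (betti_tor_dim i r resF) -rk /tor_dim.
have -> : tor_boundaries F i r = 0 by rewrite /tor_boundaries min mulmx0.
rewrite mxrank0 subn0; case: i => //= i.
apply/eqP; rewrite eqn_leq !mxrankS ?capmxSl // sub_capmx submx_refl /=.
by apply/sub_kermxP; rewrite min mulmx0.
Qed.

Lemma rank_deg_part_cat a b (da : 'I_a -> int) (db : 'I_b -> int) r :
  \rank (deg_part K (fun s => match split s with inl x => da x | inr x => db x end) r)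
  = (\rank (deg_part K da r) + \rank (deg_part K db r))%N.
Proof.
rewrite -rank_diag_block_mx /deg_part -diag_mx_row; congr (\rank (diag_mx _)).
by apply/rowP => s; rewrite !mxE; case: split => x; rewrite mxE.
Qed.

(** The bound 1 forces [J] to have a linear resolution. In position [i] its shifted generators have
    degree i + 1 + d, while those of [F] have degree at most i + hi, hence at most i + d; so the
    entries of [f] have positive degree and no constant term. *)
Lemma min_resolution_cone I J I' (hi hi' : int) b c d p :
    min_resolution I hi b -> min_resolution J 1 c -> homog_of_deg d p ->
    0 < d -> hi <= d -> d <= hi' ->
    (forall q, q \in J <-> q * p \in I) ->
    (forall q, q \in I' <-> exists2 q', q' \in I & exists c, q = q' + c * p) ->
  min_resolution I' hi' (fun i r =>
    b i r + if i is i'.+1 then c i' (r - d)%R else (r == d))%N.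
Proof.
move=> [F [resF minF degF rkF]] [Q [resQ minQ degQ rkQ]] hp d0 hid hid' colon sum.
have [f [hf rescone]] := cone_resolution resF resQ hp colon sum.
exists (cone d p f); split=> //.
- move=> i; rewrite /tor_diff /= (map_block_mx (mcoeff 0%MM)).
  rewrite [map_mx _ (gdiff F i)]minF.
  have -> : map_mx (mcoeff 0%MM) (f i) = 0.
    apply/matrixP => s t; rewrite !mxE (cst_homog_eq0 (hf i s t)) //=.
    by have := degQ i s; have := degF i t; lia.
  have -> : map_mx (mcoeff 0%MM) (ediff Q i) = 0.
    case: i => [|i]; last exact: minQ.
    apply/matrixP => s t; rewrite !mxE (cst_homog_eq0 (ediff_homog resQ 0 s t)) //=.
    by rewrite subr0; have /andP [/lt0r_neq0] := degQ 0 s.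
  by rewrite (map_mx0 (mcoeff 0%MM)) block_mx0.
- move=> i a /=; case: split => x; first by have := degF i x; lia.
  by case: i a x => [|i] a x /=; [lia|have := degQ i x; lia].
- move=> i r.
  rewrite [LHS](rank_deg_part_cat (@gdeg _ _ F i) (fun x => @edeg _ _ Q i x + d) r).
  rewrite [\rank (deg_part K (@gdeg _ _ F i) r)]rkF; congr (_ + _)%N.
  case: i => [|i] /=; last first.
    rewrite -rkQ /tor_part /deg_part; congr (\rank (diag_mx _)).
    by apply/rowP => s; rewrite !mxE -subr_eq opprK.
  rewrite (_ : deg_part K _ r = (r == d)%:R%:M).
    by case: (r == d); rewrite ?mxrank1 // raddf0 mxrank0.
  by apply/matrixP => s t; rewrite !ord1 !mxE eqxx add0r eq_sym.
Qed.

Lemma min_resolution0 I hi : (forall p, p \in I <-> p = 0) ->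
  min_resolution I hi (fun _ _ => 0%N).
Proof.
move=> I0; exists (@GradedFree K n (fun=> 0%N) (fun=> fun=> 0) (fun=> 0) 0).
split=> [|i|i []|i r] //; last by apply/eqP; rewrite mxrank_eq0 flatmx0.
- split=> /=; first by split=> [[]|i []].
  + move=> p; rewrite I0; split=> [->|[v]].
      by exists 0; rewrite mulmx0 raddf0.
    rewrite mulmx0 => /matrixP /(_ 0 0); rewrite !mxE mulr1n => <- //.
  + by move=> v; split=> _; [exists 0; rewrite mul0mx thinmx0|rewrite mulmx0].
  + by move=> i v; split=> _; [exists 0; rewrite mul0mx thinmx0|rewrite mulmx0].
- by apply: flatmx0.
Qed.

Lemma eq_min_resolution I J hi b c :
  (forall p, p \in I <-> p \in J) -> (forall i r, b i r = c i r) ->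
  min_resolution I hi b -> min_resolution J hi c.
Proof.
move=> IJ bc [F [[h0 hI h1 h2] minF degF rkF]]; exists F; split=> // [|i r].
  by split=> // p; rewrite -IJ.
by rewrite rkF.
Qed.

End MappingCone.

(** * Monomial ideals with linear quotients *)

Section MonomialIdealResolution.
Variables (K : fieldType) (n : nat).
Local Notation S := {mpoly K[n]}.
Implicit Types (s : seq 'X_{1..n}) (u v m : 'X_{1..n}) (p q : S).

(** The ideal generated by the monomials in [s], encoded by a divisibility test on supports so that
    colons become combinatorial. *)
Definition monid s : {pred S} :=
  fun p => all (fun m => has (fun u => (u <= m)%MM) s) (msupp p).

Lemma monidP s p :
  p \in monid s <-> forall m, p@_m != 0 -> has (fun u => (u <= m)%MM) s.
Proof.
split=> [/allP h m hm|h]; first by apply: h; rewrite mcoeff_msupp.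
by apply/allP => m; rewrite mcoeff_msupp; apply: h.
Qed.

Lemma monidD s p q : p \in monid s -> q \in monid s -> p + q \in monid s.
Proof.
move=> /monidP hp /monidP hq; apply/monidP => m; rewrite mcoeffD.
by have [->|/hp //] := eqVneq p@_m 0; rewrite add0r => /hq.
Qed.

Lemma mcoeff_mulX p u m :
  (p * 'X_[u])@_m = if (u <= m)%MM then p@_(m - u) else 0.
Proof.
case: ifPn => [le_um|nle]; first by rewrite -{1}(submK le_um) addmC mcoeffMX.
apply: memN_msupp_eq0; rewrite (perm_mem (msuppMX p u)).
by apply: contra nle => /mapP [m' _ ->]; apply: lem_addr.
Qed.

Lemma monid_colon s u p :
  p * 'X_[u] \in monid s <->
  forall m, p@_m != 0 -> has (fun v => (v <= m + u)%MM) s.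
Proof.
split=> [/monidP h m hm|h]; first by apply: h; rewrite addmC mcoeffMX.
apply/monidP => m; rewrite mcoeff_mulX; case: ifP => [le_um|_]; last by rewrite eqxx.
by move=> /h; rewrite submK.
Qed.

Lemma monid_cons s u p :
  p \in monid (u :: s) <->
  exists2 q, q \in monid s & exists c, p = q + c * 'X_[u].
Proof.
split=> [/monidP hp|[q /monidP hq [c ->]]].
  (* Monomials of [p] not divisible by [u] must be divisible by a member of [s]; the others go into
     the multiple of ['X_[u]]. *)
  exists (\sum_(m <- msupp p | ~~ (u <= m)%MM) p@_m *: 'X_[m]).
    elim/big_ind: _ => [||m nle]; [by apply/allP => m; rewrite msupp0|exact: monidD|].
    apply/monidP => v; rewrite mcoeffZ mcoeffX.
    case: (eqVneq m v) => [<-|_]; last by rewrite mulr0 eqxx.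
    by rewrite mulr1 => /hp /=; rewrite (negbTE nle).
  exists (\sum_(m <- msupp p | (u <= m)%MM) p@_m *: 'X_[m - u]).
  rewrite {1}(mpolyE p) (bigID (fun m => u <= m)%MM) /= addrC; congr (_ + _).
  rewrite mulr_suml; apply: eq_bigr => m le_um.
  by rewrite -scalerAl -mpolyXD submK.
apply/monidP => m; rewrite mcoeffD mcoeff_mulX /=.
by case: ifP => //= _; rewrite addr0; apply: hq.
Qed.

Lemma monid0 p : p \in monid [::] <-> p = 0.
Proof.
split=> [/monidP h|->]; last by apply/allP => m; rewrite msupp0.
by apply/mpolyP => m; rewrite mcoeff0; apply/eqP; apply: contraT => /h.
Qed.

(** The Betti numbers of the Koszul complex. A new variable is a nonzerodivisor modulo the old ones,
    so the colon is the old ideal itself, [IH] serves twice, and the binomials add up by Pascal's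
    rule. *)
Lemma monid_vars_min_resolution (vars : seq 'I_n) : uniq vars ->
  min_resolution (monid [seq U_(l)%MM | l <- vars]) 1
    (fun i r => (r == i%:Z + 1)%R * 'C(size vars, i.+1))%N.
Proof.
elim: vars => [_|l vars IH /= /andP [l_vars /IH {}IH]].
  apply: (eq_min_resolution _ _ (min_resolution0 1 (fun p : S => monid0 p))) => //.
  by move=> i r; rewrite bin0n muln0.
have cone := min_resolution_cone (d := 1) (p := 'X_[U_(l)]) (hi' := 1) IH IH.
apply: (eq_min_resolution (fun p => iff_refl _) _ (cone _ _ _ _ _ _ _)) => //.
- case=> [|i] r /=; rewrite binS mulnDr; congr addn.
    by rewrite bin0 muln1 add0r.
  by congr (_ * _)%N; apply/eqP/eqP; lia.
- by have := @homogX K n U_(l); rewrite mdeg1.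
- move=> q; rewrite monid_colon; split=> [/monidP h m /h|h].
    by apply: sub_has => v /lepm_trans; apply; apply: lem_addr.
  apply/monidP => m /h /hasP [_ /mapP [l' l'_vars ->] le].
  apply/hasP; exists U_(l')%MM; first exact: map_f.
  move: le; rewrite !lep1mP mnmDE mnm1E.
  by case: (l =P l') l_vars => [->|_ _]; rewrite ?l'_vars ?addn0.
- by move=> q; apply: monid_cons.
Qed.

(** The list is built from its tail: [s2] holds the generators adjoined before [u], and degrees
    weakly decrease along [s]. Position [i] of the resolution of the colon ideal lands in position
    [i.+1] of the cone, which turns its binomial with lower index [i.+1] into the one claimed. *)
Lemma linear_quotients_min_resolution (vars : 'X_{1..n} -> seq 'I_n) s (hi : nat) :
    (forall u s1 s2, s = s1 ++ u :: s2 ->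
      [/\ (0 < mdeg u)%N, uniq (vars u), all (fun v => mdeg v <= mdeg u)%N s2
        & forall m, has (fun v => (v <= m + u)%MM) s2 =
                    has (fun l => 0 < m l)%N (vars u)]) ->
    all (fun v => mdeg v <= hi)%N s ->
  min_resolution (monid s) hi%:Z
    (fun i r => \sum_(u <- s | (r == i%:Z + (mdeg u)%:Z)%R) 'C(size (vars u), i))%N.
Proof.
elim: s hi => [|u s IH] hi lq; first move=> _.
  apply: (eq_min_resolution _ _ (min_resolution0 hi%:Z (fun p : S => monid0 p))) => //.
  by move=> i r; rewrite big_nil.
case/andP => u_hi _; have [u0 u_uniq s_u colon] := lq u [::] s (erefl _).
have {}IH := IH (mdeg u) (fun v s1 s2 E => lq v (u :: s1) s2 (congr1 (cons u) E)) s_u.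
have resV := monid_vars_min_resolution u_uniq.
have cone := min_resolution_cone (d := (mdeg u)%:Z) (p := 'X_[u]) (hi' := hi%:Z) IH resV.
apply: (eq_min_resolution (fun p => iff_refl _) _ (cone _ _ _ _ _ _ _)) => //.
- move=> i r; rewrite big_cons; case: i => [|i] /=.
    by rewrite add0r bin0; case: ifP; rewrite ?addn0 // addnC.
  rewrite (_ : (r - (mdeg u)%:Z == i%:Z + 1) = (r == i.+1%:Z + (mdeg u)%:Z)); last first.
    by apply/eqP/eqP; lia.
  by case: ifP; rewrite ?mul0n ?addn0 // mul1n addnC.
- exact: homogX.
- move=> q; rewrite monid_colon; split=> [/monidP h m /h|h].
    rewrite has_map colon; apply: sub_has => l /=; by rewrite lep1mP lt0n.
  apply/monidP => m /h; rewrite colon has_map.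
  by apply: sub_has => l /=; rewrite lep1mP lt0n.
- by move=> q; apply: monid_cons.
Qed.

End MonomialIdealResolution.

(** * Exponent vectors and generators *)

Section Exponents.
Variable n : nat.
Implicit Types u v m : 'X_{1..n}.

Lemma lem_mdeg_eq u v : (u <= v)%MM -> (mdeg v <= mdeg u)%N -> u = v.
Proof.
move=> le_uv; rewrite -{1 2}(submK le_uv) mdegD -{2}[mdeg u]add0n leq_add2r leqn0.
by rewrite mdeg_eq0 => /eqP ->; rewrite add0m.
Qed.

Lemma exchangeE u (j i l : 'I_n) : exchange u j i l = (u l - (j == l) + (i == l))%N.
Proof. by rewrite !mnmE. Qed.

Lemma mdeg_exchange u (j i : 'I_n) : (0 < u j)%N -> mdeg (exchange u j i) = mdeg u.
Proof.
rewrite lt0n -lep1mP => le_ju.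
by rewrite -[in RHS](submK le_ju) /exchange !mdegD !mdeg1.
Qed.

(** The weight counts each variable with its index; its descent is the termination measure for
    repeated exchanges. *)
Lemma mnmwgt_exchange u (j i : 'I_n) : (0 < u j)%N -> (i < j)%N ->
  (mnmwgt (exchange u j i) < mnmwgt u)%N.
Proof.
rewrite lt0n -lep1mP => le_ju lt_ij.
by rewrite -[in ltnRHS](submK le_ju) /exchange !mnmwgtD !mnmwgt1 ltn_add2l.
Qed.

Lemma mvar_ge u (l : 'I_n) : (0 < u l)%N -> (l < mvar u)%N.
Proof. exact: (@leq_bigmax_cond _ _ (fun l : 'I_n => l.+1)). Qed.

Lemma mvar_leq u : (mvar u <= n)%N.
Proof. by apply/bigmax_leqP => l _; apply: ltn_ord. Qed.

Lemma mvarP u : (0 < mvar u)%N -> exists2 j : 'I_n, (0 < u j)%N & mvar u = j.+1.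
Proof.
move=> m0; case: (pickP (fun l : 'I_n => 0 < u l)%N) => [l ul|u0].
  by have [|j] := @eq_bigmax_cond _ (fun l : 'I_n => 0 < u l)%N (fun l : 'I_n => l.+1);
    [apply/card_gt0P; exists l|exists j].
by move: m0; rewrite /mvar big_pred0.
Qed.

Definition free_vars (k : nat) u : seq 'I_n :=
  [seq l : 'I_n <- enum 'I_n | (l.+1 < mvar u)%N && (u l < k)%N].

(** The m(u) - 1 indices below m(u) split into those with exponent less than [k] and those with
    exponent exactly [k]. For u = 1 truncated subtraction makes both sides 0. *)
Lemma size_free_vars k u : kbounded k u ->
  size (free_vars k u) = (mvar u - Lvar k u - 1)%N.
Proof.
move=> /forallP uk.
have -> : size (free_vars k u) = #|[set l : 'I_n | (l.+1 < mvar u)%N && (u l < k)%N]|.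
  rewrite cardE [in RHS]/enum_mem /free_vars enumT !size_filter.
  by apply: eq_count => l; rewrite /= inE.
suff : (#|[set l : 'I_n | (l.+1 < mvar u)%N && (u l < k)%N]| + Lvar k u = mvar u - 1)%N by lia.
have -> : (mvar u - 1 = #|[set l : 'I_n | (l.+1 < mvar u)%N]|)%N.
  have le : (mvar u - 1 <= n)%N by have := mvar_leq u; lia.
  have inj : injective (widen_ord le) by move=> x y /(congr1 val) /= /val_inj.
  rewrite -[LHS]card_ord -(card_imset _ inj).
  apply: eq_card => l; rewrite inE; apply/imsetP/idP => [[x _ ->] /=|hl].
    by have := ltn_ord x; lia.
  have hl' : (l < mvar u - 1)%N by lia.
  by exists (Ordinal hl') => //; apply: val_inj.
rewrite -(cardsID [set l : 'I_n | (u l < k)%N] [set l : 'I_n | (l.+1 < mvar u)%N]) /Lvar.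
congr (_ + _)%N; apply: eq_card => l; rewrite !inE // andbC; congr andb.
by rewrite -leqNgt eqn_leq uk.
Qed.

End Exponents.

(** * Minimal monomial generators *)

Section Generators.
Variables (K : fieldType) (n : nat).
Local Notation S := {mpoly K[n]}.
Implicit Types (A : 'X_{1..n} -> Prop) (I : {pred S}) (p : S).

Lemma comb_monomialsP A p :
  (exists s : seq (S * 'X_{1..n}),
      (forall t, t \in s -> A t.2) /\ p = \sum_(t <- s) t.1 * 'X_[t.2]) <->
  (forall m, p@_m != 0 -> exists2 a, A a & (a <= m)%MM).
Proof.
split=> [[s [sA ->]] m|h].
  elim: s sA => [|t s IH] sA; first by rewrite big_nil mcoeff0 eqxx.
  rewrite big_cons mcoeffD mcoeff_mulX.
  case: ifP => [le _|_]; first by exists t.2 => //; apply: sA; rewrite mem_head.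
  by rewrite add0r; apply: IH => x xs; apply: sA; rewrite inE xs orbT.
pose C p := exists s : seq (S * 'X_{1..n}),
  (forall t, t \in s -> A t.2) /\ p = \sum_(t <- s) t.1 * 'X_[t.2].
rewrite -/(C p) (mpolyE p) big_seq; apply: (big_ind C) => [|q r|m].
- by exists [::]; rewrite big_nil.
- move=> [s [sA ->]] [s' [sA' ->]]; exists (s ++ s'); rewrite big_cat; split=> // t.
  by rewrite mem_cat => /orP [/sA|/sA'].
rewrite mcoeff_msupp => /h [a Aa le]; exists [:: (p@_m *: 'X_[m - a], a)].
split=> [t|]; first by rewrite inE => /eqP ->.
by rewrite big_seq1 /= -scalerAl -mpolyXD submK.
Qed.

Lemma generatesP A I : generates A I <->
  forall p, p \in I <-> forall m, p@_m != 0 -> exists2 a, A a & (a <= m)%MM.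
Proof.
by split=> h p; [rewrite -comb_monomialsP|rewrite comb_monomialsP]; apply: h.
Qed.

Lemma generates_monomial A I u : generates A I ->
  'X_[u] \in I <-> exists2 a, A a & (a <= u)%MM.
Proof.
move=> /generatesP ->; split=> [|[a Aa le] m]; first by apply; rewrite mcoeffX eqxx oner_eq0.
by rewrite mcoeffX; case: (u =P m) => [<-|]; [exists a|rewrite eqxx].
Qed.

Lemma generates_monid (G : {fset 'X_{1..n}}) (s : seq 'X_{1..n}) I :
  G =i s -> generates (fun u => u \in G) I -> forall p, p \in monid s <-> p \in I.
Proof.
move=> Gs /generatesP h p; rewrite h monidP.
split=> hp m /hp; first by move=> /hasP [a as_ le]; exists a; rewrite ?Gs.
by move=> [a aG le]; apply/hasP; exists a; rewrite -?Gs.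
Qed.

(** Otherwise [v] could be dropped from [G], since [u] divides every multiple of [v]. *)
Lemma minimal_generators_le I G u v : is_minimal_generators I G ->
  u \in G -> v \in G -> (u <= v)%MM -> u = v.
Proof.
move=> [/generatesP gen min] uG vG le; apply/eqP; apply: contraT => ne.
have E : (G `\ v)%fset = G.
  apply: min; first exact: fsubD1set.
  apply/generatesP => p; rewrite gen; split=> h m /h [a]; last first.
    by rewrite !inE => /andP [_ aG] am; exists a.
  move=> aG am; have [av|av] := eqVneq a v.
    by exists u; rewrite ?inE ?ne //; apply: lepm_trans le _; rewrite -av.
  by exists a; rewrite // !inE av.
by move: vG; rewrite -E !inE eqxx.
Qed.

End Generators.

(** * k-Borel ideals *)

Section KBorel.
Variables (K : fieldType) (n k : nat) (I : {pred {mpoly K[n]}}).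
Variable (G : {fset 'X_{1..n}}).
Hypotheses (I_kBorel : kBorel k I) (G_min : is_minimal_generators I G).
Implicit Types u v w m : 'X_{1..n}.

Let G_gen : generates (fun u => u \in G) I := proj1 G_min.

Lemma generator_in u : u \in G -> 'X_[u] \in I.
Proof. by move=> uG; apply/(generates_monomial _ G_gen); exists u; rewrite ?lepm_refl. Qed.

Lemma generator_below u : 'X_[u] \in I -> exists2 g, g \in G & (g <= u)%MM.
Proof. by move/(generates_monomial _ G_gen). Qed.

(** The [k]-bounded generating set [A] need not be [G], but [u] has a divisor [a] in [A], which has
    a divisor in [G]; minimality makes all three equal. *)
Lemma generator_kbounded u : u \in G -> kbounded k u.
Proof.
move=> uG; have [[A A_bd A_gen] _] := I_kBorel.
have /(generates_monomial _ A_gen) [a Aa le_au] := generator_in uG.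
have /generator_below [g gG le_ga] : 'X_[a] \in I.
  by apply/(generates_monomial _ A_gen); exists a; rewrite ?lepm_refl.
have gu : g = u by apply: minimal_generators_le G_min gG uG (lepm_trans le_ga le_au).
suff -> : u = a by apply: A_bd.
by apply/mnmP => l; apply/eqP; rewrite eqn_leq (mnm_lepP le_au) -{1}gu (mnm_lepP le_ga).
Qed.

(* Moving variables of v from positions where v exceeds u to positions where
   it falls short of u keeps the degree and ends at a proper divisor of u. *)
Lemma kBorel_mdeg_geq u v : u \in G -> kbounded k v -> 'X_[v] \in I ->
    (forall l : 'I_n, (l.+1 < mvar u)%N -> (v l <= u l)%N) ->
  (mdeg u <= mdeg v)%N.
Proof.
move=> uG; have [w lew] := ubnP (mnmwgt v); elim: w v lew => // w IH v lew v_bd vI v_le.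
have [/'exists_idP [l lt_l]|/existsPn v_le'] := boolP [exists l, u l < v l]%N; last first.
  have le_vu : (v <= u)%MM by apply/mnm_lepP => l; rewrite leqNgt v_le'.
  have [g gG le_gv] := generator_below vI.
  have -> : u = g.
    by apply/esym/(minimal_generators_le G_min gG uG)/(lepm_trans le_gv le_vu).
  by rewrite -(submK le_gv) mdegD leq_addl.
rewrite leqNgt; apply/negP => deg_lt.
have [/'exists_idP [i lt_i]|/existsPn u_le] := boolP [exists i, v i < u i]%N; last first.
  move: deg_lt; rewrite ltnNge; apply/negP; rewrite negbK !mdegE.
  by apply: leq_sum => x _; rewrite leqNgt u_le.
(* The excess of [v] sits at or beyond the last variable of [u], the deficit at a variable that
   divides [u]; so the exchange goes in the Borel direction. *)
have lt_il : (i < l)%N.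
  have := mvar_ge (leq_ltn_trans (leq0n _) lt_i).
  have [/v_le|] := ltnP l.+1 (mvar u); first by lia.
  have : i != l by apply: contraTneq lt_i => ->; rewrite -leqNgt ltnW.
  by rewrite -val_eqE /=; lia.
have v_l : (0 < v l)%N by exact: leq_ltn_trans lt_l.
have ul_bd := forallP (generator_kbounded uG).
have v'_bd : kbounded k (exchange v l i).
  apply/forallP => x; rewrite exchangeE; have := forallP v_bd x.
  by case: (i =P x) => [<-|_]; [have := ul_bd i|]; lia.
suff : (mdeg u <= mdeg (exchange v l i))%N by rewrite mdeg_exchange // leqNgt deg_lt.
apply: IH => //.
- by have := mnmwgt_exchange v_l lt_il; lia.
- by have [_ borel] := I_kBorel; apply: borel.
move=> x hx; rewrite exchangeE; case: (i =P x) => [<-|_]; last by have := v_le x hx; lia.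
by lia.
Qed.

(** On monomials of equal degree the library order compares lexicographically from the first
    variable. Sorting by [later] puts the last generator first, so that tails consist of
    predecessors. *)
Definition later : rel 'X_{1..n} := fun u v =>
  (mdeg v < mdeg u)%N || ((mdeg v == mdeg u) && (u <= v)%O).

Lemma later_total : total later.
Proof. by move=> u v; rewrite /later; case: ltngtP => //= _; apply: le_total. Qed.

Lemma later_trans : transitive later.
Proof.
move=> v u w; rewrite /later; case: ltngtP => //= [lt_vu _|-> le_uv].
  by case: ltngtP => //= [lt_wv _|->]; rewrite ?lt_vu // (ltn_trans lt_wv).
by case: ltngtP => //= _ ; apply: le_trans.
Qed.

Lemma later_anti u v : later u v -> later v u -> u = v.
Proof.
rewrite /later; case: ltngtP => //= _ uv vu; apply/eqP.
by rewrite eq_le uv vu.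
Qed.

Lemma linear_quotient u m (P : pred 'X_{1..n}) : u \in G ->
    (forall v, P v = [&& v \in G, v != u & later u v]) ->
  (exists2 v, P v & (v <= m + u)%MM) <-> has (fun l => 0 < m l)%N (free_vars k u).
Proof.
move=> uG PE; split=> [[v]|/hasP [l]].
  rewrite PE => /and3P [vG ne_vu late] /mnm_lepP le_v.
  have v_bd := generator_kbounded vG.
  (* If [v] exceeds [u] at some [l] before m(u), then [u l < v l <= k], and divisibility of m + u by
     [v] forces [m l] to be positive. *)
  have [/'exists_idP [l /andP [lm lt_uv]]|/existsPn h] :=
      boolP [exists l : 'I_n, (l.+1 < mvar u) && (u l < v l)]%N.
    apply/hasP; exists l; last by have := le_v l; rewrite mnmDE; lia.
    rewrite mem_filter mem_enum lm andbT /=.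
    exact: leq_trans lt_uv (forallP v_bd l).
  have v_le (l : 'I_n) : (l.+1 < mvar u)%N -> (v l <= u l)%N.
    by move=> lm; have := h l; rewrite lm -leqNgt.
  have deg_uv := kBorel_mdeg_geq uG v_bd (generator_in vG) v_le.
  case/orP: late => [|/andP [/eqP deg_eq le_uv]]; first by rewrite ltnNge deg_uv.
  have : (u < v)%O by rewrite lt_neqAle eq_sym ne_vu.
  (* The first difference is an excess of [v], so it lies at or beyond the last variable of [u].
     Then [u] divides [v], against minimality. *)
  case/ltmcP => // i eq_lt lt_i.
  have im : (mvar u <= i.+1)%N by rewrite leqNgt; apply/negP => /v_le; lia.
  suff le_uv' : (u <= v)%MM.
    by rewrite (minimal_generators_le G_min uG vG le_uv') eqxx in ne_vu.
  apply/mnm_lepP => x; have [/eq_lt ->//|lt_ix|/val_inj ->] := ltngtP x i; last exact: ltnW.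
  case: (posnP (u x)) => [->//|/mvar_ge]; lia.
rewrite mem_filter => /andP [/andP [lm lt_k] _] m_l.
have [j u_j mE] := mvarP (leq_ltn_trans (leq0n _) lm).
have lt_lj : (l < j)%N by lia.
have u_bd := generator_kbounded uG.
have w_bd : kbounded k (exchange u j l).
  apply/forallP => x; rewrite exchangeE; have := forallP u_bd x.
  by case: (l =P x) => [<-|_]; lia.
have wI : 'X_[exchange u j l] \in I.
  by have [_ borel] := I_kBorel; apply: borel (generator_in uG) _ _ _.
have deg_w : mdeg (exchange u j l) = mdeg u by rewrite mdeg_exchange.
(* The generator [g] below the exchanged monomial is a predecessor: it has smaller degree, or it
   equals that monomial, which is lexicographically larger than [u] because [l < j]. *)
have [g gG le_gw] := generator_below wI; exists g; last first.
  apply: lepm_trans le_gw _; apply/mnm_lepP => x; rewrite exchangeE mnmDE.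
  by case: (l =P x) => [<-|_]; lia.
have deg_g : (mdeg g <= mdeg u)%N by rewrite -deg_w -(submK le_gw) mdegD leq_addl.
have [gw|lt_g] := leqP (mdeg u) (mdeg g); last first.
  rewrite PE gG /later lt_g andbT; by apply: contraTneq lt_g => ->; rewrite ltnn.
have {gw} gE : g = exchange u j l by apply: lem_mdeg_eq => //; rewrite deg_w.
have lt_ug : (u < g)%O.
  apply/ltmcP; first by rewrite gE deg_w.
  have jl : (j == l) = false by apply: gtn_eqF lt_lj.
  exists l => [x lt_xl|]; rewrite gE exchangeE; last by rewrite jl eqxx subn0 addn1.
  have lx : (l == x) = false by apply: gtn_eqF lt_xl.
  have jx : (j == x) = false by apply: gtn_eqF (ltn_trans lt_xl lt_lj).
  by rewrite lx jx subn0 addn0.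
rewrite PE gG /later gE deg_w eqxx -gE (ltW lt_ug) orbT andbT.
by rewrite eq_sym lt_eqF.
Qed.

Lemma kBorel_min_resolution : 1 \notin I ->
  exists hi, min_resolution I hi
    (fun i r => \sum_(u <- G | r == (i%:Z + (mdeg u)%:Z)%R)
      'C(mvar u - Lvar k u - 1, i))%N.
Proof.
move=> I1; pose s := sort later G; have s_perm : perm_eq s G by rewrite perm_sort.
have sG : G =i s by move=> u; rewrite (perm_mem s_perm).
have s_uniq : uniq s by rewrite sort_uniq fset_uniq.
exists (\max_(u <- s) mdeg u)%:Z.
apply: (eq_min_resolution (generates_monid sG G_gen) _
         (@linear_quotients_min_resolution K n (free_vars k) s _ _ _)).
- move=> i r; rewrite (perm_big _ s_perm) /= big_seq_cond [RHS]big_seq_cond.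
  apply: eq_bigr => u /andP [uG _]; rewrite size_free_vars //.
  exact: generator_kbounded.
- move=> u s1 s2 sE; have uG : u \in G by rewrite sG sE mem_cat mem_head orbT.
  have : pairwise later s.
    by rewrite -(sorted_pairwise later_trans) sort_sorted //; apply: later_total.
  rewrite sE pairwise_cat /= => /and3P [/allrelP s1_late _ /andP [u_late _]].
  (* In the sorted list the entries after [u] are exactly its predecessors in [G], by antisymmetry
     of [later]. *)
  have s2E v : v \in s2 = [&& v \in G, v != u & later u v].
    move: s_uniq; rewrite sG sE cat_uniq /= !mem_cat !inE => /and4P [_ nhas u_s2 _].
    apply/idP/and3P => [v_s2|[v_s ne late]].
      rewrite v_s2 !orbT (allP u_late v v_s2); split=> //.
      by apply: contraNneq u_s2 => <-.
    case/or3P: v_s => // [v_s1|]; last by rewrite (negbTE ne).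
    have := s1_late v u v_s1 (mem_head _ _) => late'.
    by rewrite (later_anti late late') eqxx in ne.
  split.
  (* A generator of degree 0 would be 1, which a proper ideal does not contain. *)
  + rewrite lt0n mdeg_eq0; apply: contraNneq I1 => u0.
    by have := generator_in uG; rewrite u0 mpolyX0.
  + by rewrite filter_uniq ?enum_uniq.
  + apply/allP => v; rewrite s2E => /and3P [_ _]; rewrite /later.
    by case: ltngtP.
  move=> m; apply/hasP/idP => [|h]; first by move/(linear_quotient m uG s2E).
  by apply/(linear_quotient m uG s2E).
apply/allP => u us; exact: (@leq_bigmax_seq _ s xpredT (fun u => mdeg u) u us isT).
Qed.

End KBorel.

Theorem corollary2p3 (K : fieldType) (n k : nat) (I : {pred {mpoly K[n]}})
    (G : {fset 'X_{1..n}}) (k_ge1 : (1 <= k)%N)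
    (I_ideal : idealr_closed I) (I_kBorel : kBorel k I)
    (G_gens : is_minimal_generators I G) (i : nat) (j : int) :
  betti I i (i%:Z + j) =
  (\sum_(u <- G | (mdeg u)%:Z == j) 'C(mvar u - Lvar k u - 1, i))%N.
Proof.
(* Properness of the ideal is the second clause of [idealr_closed]. *)
have [_ I1 _] := I_ideal.
have [hi res] := kBorel_min_resolution I_kBorel G_gens I1.
rewrite (min_resolution_betti _ _ res); apply: eq_bigl => u.
by rewrite (inj_eq (addrI _)) eq_sym.
Qed.
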